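(* Let $q=2^m$, where $m$ is a positive integer. Let $a,b,c,d\in\mathbb{F}_{q^2}$ be not all zero, and let $g(x)=\frac{d^qx^3+c^qx^2+b^qx+a^q}{ax^3+bx^2+cx+d}\in\mathbb{F}_{q^2}(x)$. Assume that $\deg(g)=2$. Then $g(x)$ permutes $\mu_{q+1}$ if and only if one of the following holds: (1) $c=d=0$, $a,b\neq 0$ and $\frac{a}{b}\in\mu_{q+1}$; (2) $c,d\neq 0$, $a=b=0$, and $\frac{d}{c}\in\mu_{q+1}$; (3) $a,b,c,d\neq 0$ and $\frac{c^q}{d^q}=\frac{b}{a}=\frac{d}{c}=\frac{a^q}{b^q}=\frac{d^{q+1}-a^{q+1}}{d^qc-ab^q}\in\mu_{q+1}$.
   Context: $\mu_{q+1}$ denotes the set of $(q+1)$-th roots of unity in $\mathbb{F}_{q^2}$. A rational function is identified with its reduced form $N_0/D_0$ with $N_0,D_0$ coprime; its degree is $\max(\deg N_0,\deg D_0)$, and it is viewed as a map on the projective line via the reduced form. A rational function permutes a set $S$ if it restricts to a bijection $S\to S$. A condition involving a quotient includes the requirement that its denominator is nonzero. *)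

(* Defs.v *)
(* MathComp *)
From mathcomp Require Import all_boot all_order all_algebra.

Set Implicit Arguments.
Unset Strict Implicit.
Unset Printing Implicit Defensive.

Import GRing.Theory.
Local Open Scope ring_scope.

Notation "x %:F" := (@FracField.tofrac _ x) : ring_scope.

(* The representative chosen by [repr] need not be in lowest terms, hence the
   division by the gcd.  The reduced form is canonical only up to a common
   nonzero scalar, which affects neither the degree nor the induced map. *)
Definition rat_num (F : fieldType) (g : {fraction {poly F}}) : {poly F} :=
  let r := repr g in \n_r %/ gcdp \n_r \d_r.

Definition rat_den (F : fieldType) (g : {fraction {poly F}}) : {poly F} :=
  let r := repr g in \d_r %/ gcdp \n_r \d_r.

Definition rat_deg (F : fieldType) (g : {fraction {poly F}}) : nat :=
  maxn (size (rat_num g)).-1 (size (rat_den g)).-1.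

(* The projective line over F is [option F], [None] being the point at
   infinity.  At infinity the homogenizations of degree [rat_deg g] take as
   values the coefficients of 'X^(rat_deg g). *)
Definition rat_map (F : fieldType) (g : {fraction {poly F}}) (x : option F)
    : option F :=
  let n := if x is Some t then (rat_num g).[t] else (rat_num g)`_(rat_deg g) in
  let d := if x is Some t then (rat_den g).[t] else (rat_den g)`_(rat_deg g) in
  if d == 0 then None else Some (n / d).

Definition permutes (F : finFieldType) (g : {fraction {poly F}}) (S : {set F})
    : Prop :=
  let S1 : {set option F} := [set Some x | x in S] in
  {in S1 &, injective (rat_map g)} /\ [set rat_map g P | P in S1] = S1.

Definition mu (F : finFieldType) (n : nat) : {set F} :=
  [set x | n.-unity_root x].

Lemma rat_den_neq0 (F : fieldType) (g : {fraction {poly F}}) : rat_den g != 0.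
Proof.
rewrite /rat_den; have d0 := denom_ratioP (repr g).
by rewrite dvdp_div_eq0 ?dvdp_gcdr.
Qed.

Lemma rat_coprime (F : fieldType) (g : {fraction {poly F}}) :
  coprimep (rat_num g) (rat_den g).
Proof.
by apply: coprimep_div_gcd; rewrite (denom_ratioP (repr g)) orbT.
Qed.

Lemma rat_numden (F : fieldType) (g : {fraction {poly F}}) :
  g = (rat_num g)%:F / (rat_den g)%:F.
Proof.
have fracE (r : {ratio {poly F}}) :
    \pi_({fraction {poly F}})%qT r = (\n_r)%:F / (\d_r)%:F.
  have d0 := denom_ratioP r.
  apply: (canRL (mulfK _)); first by rewrite tofrac_eq0.
  rewrite !piE; apply/eqmodP; rewrite /= FracField.equivfE /FracField.mulf.
  by rewrite !numden_Ratio ?mulr1 ?oner_neq0 // mulrC.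
rewrite -{1}[g]reprK fracE /rat_num /rat_den.
set n := \n_(repr g); set d := \d_(repr g).
have d0 : d != 0 by exact: denom_ratioP.
have e0 : gcdp n d != 0 by rewrite gcdp_eq0 negb_and d0 orbT.
set e := gcdp n d in e0 *.
have -> : n%:F / d%:F = (n %/ e * e)%:F / (d %/ e * e)%:F.
  by rewrite !divpK ?dvdp_gcdl ?dvdp_gcdr.
by rewrite !tofracM -mulf_div divff ?mulr1 // tofrac_eq0.
Qed.

(* Main.v *)
Require Import Defs.
From mathcomp Require Import all_boot all_order all_algebra.
From mathcomp Require Import finfield ring.

Set Implicit Arguments.
Unset Strict Implicit.
Unset Printing Implicit Defensive.

Import GRing.Theory.
Local Open Scope ring_scope.

(** Write N and D for the two cubics.  They are self-reciprocal to each other: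
    N(x) = x^3 D*(1/x), where D* has the coefficients of D conjugated by
    x |-> x^q.  Hence s |-> s^(-q) permutes their common nonzero roots.  As the
    reduced fraction has degree 2, the cubics have a common factor of degree 1,
    X + r, whose root is fixed by this map, so r lies in mu_(q+1)
    ([common_factor_linear]).  Cancelling it ([reduced_form]) leaves

      g = r^-1 (C^q X^2 + B^q X + a^q) / (a X^2 + B X + C),
      b = B + r a,   c = C + r B,   d = r C.

    This maps mu_(q+1) to itself, so permuting it means being injective on it,
    and that happens exactly when B = 0 ([quadratic_injective_mu]).  Indeed, for
    B = 0 the map is t |-> t^2 followed by an invertible Moebius map.  For B
    nonzero the map is separable of degree 2; the involution exchanging the two
    points of a fibre preserves mu_(q+1) and, in characteristic 2, has only one
    fixed point, so that two points of mu_(q+1) collide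
    ([quadratic_collision]).

    Finally B = 0 says b = r a and d = r c, which is what the three
    listed cases amount to ([middle_coef0_conditions]). *)

(** * Polynomials of low degree and reduced fractions *)

Definition cubic (F : fieldType) (a b c d : F) : {poly F} :=
  a *: 'X^3 + b *: 'X^2 + c *: 'X + d%:P.

Definition quadratic (F : fieldType) (a b c : F) : {poly F} :=
  a *: 'X^2 + b *: 'X + c%:P.

Lemma cubicE (F : fieldType) (a b c d t : F) :
  (cubic a b c d).[t] = a * t ^+ 3 + b * t ^+ 2 + c * t + d.
Proof. by rewrite /cubic !hornerE. Qed.

Lemma quadraticE (F : fieldType) (a b c t : F) :
  (quadratic a b c).[t] = a * t ^+ 2 + b * t + c.
Proof. by rewrite /quadratic !hornerE. Qed.

Lemma coef_cubic (F : fieldType) (a b c d : F) i :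
  (cubic a b c d)`_i = [:: d; c; b; a]`_i.
Proof.
rewrite /cubic !coefE; case: i => [|[|[|[|i]]]] /=;
  by rewrite ?nth_nil ?mulr0 ?mulr1 ?addr0 ?add0r.
Qed.

Lemma coef_quadratic (F : fieldType) (a b c : F) i :
  (quadratic a b c)`_i = [:: c; b; a]`_i.
Proof.
rewrite /quadratic !coefE; case: i => [|[|[|i]]] /=;
  by rewrite ?nth_nil ?mulr0 ?mulr1 ?addr0 ?add0r.
Qed.

Lemma size_cubic (F : fieldType) (a b c d : F) : (size (cubic a b c d) <= 4)%N.
Proof. by apply/leq_sizeP => -[|[|[|[|j]]]] // _; rewrite coef_cubic /= nth_nil. Qed.

Lemma poly_size3 (F : fieldType) (p : {poly F}) :
  (size p <= 3)%N -> p = quadratic p`_2 p`_1 p`_0.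
Proof.
move=> sp; apply/polyP => -[|[|[|i]]]; rewrite coef_quadratic //= nth_nil.
by rewrite nth_default // (leq_trans sp).
Qed.

Lemma mulXD_quadratic (F : fieldType) (r a b c : F) :
  ('X + r%:P) * quadratic a b c = cubic a (b + r * a) (c + r * b) (r * c).
Proof.
by apply/polyP => i; rewrite mulrDl coefD coefXM coefCM !coef_quadratic coef_cubic;
  case: i => [|[|[|[|i]]]] /=; rewrite ?nth_nil ?mulr0 ?add0r ?addr0.
Qed.

(** Proportional coprime polynomials are constant; this is how reducedness of a
    fraction of positive degree excludes degenerate coefficients. *)
Lemma coprimep_scale_eq0 (F : fieldType) (p s : {poly F}) (x y : F) :
  coprimep p s -> (1 < maxn (size p) (size s))%N -> x *: p = y *: s ->
  x = 0 /\ y = 0.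
Proof.
have half (p1 s1 : {poly F}) (x1 y1 : F) : coprimep p1 s1 ->
    (1 < maxn (size p1) (size s1))%N -> x1 *: p1 = y1 *: s1 -> x1 = 0.
  move=> cop sz E; apply/eqP/negP => /negP x0.
  have Ep : p1 = (y1 / x1) *: s1.
    by rewrite mulrC -scalerA -E scalerA mulVf ?scale1r.
  have : size s1 == 1%N.
    rewrite -coprimepp; apply: coprimep_dvdr cop.
    by rewrite Ep -mul_polyC dvdp_mull.
  move=> /eqP s1E; move: sz; rewrite s1E.
  have : (size p1 <= 1)%N by rewrite Ep (leq_trans (size_scale_leq _ _)) ?s1E.
  by case: (size p1) => [|[|]].
move=> cop sz E; split; first exact: half cop sz E.
by apply: (half s p y x) => //; [rewrite coprimep_sym | rewrite maxnC].
Qed.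

Lemma no_common_root (F : fieldType) (p s : {poly F}) t :
  coprimep p s -> p.[t] = 0 -> s.[t] = 0 -> False.
Proof.
move=> cop /eqP pt /eqP; apply/negP; exact: (coprimep_root cop pt).
Qed.

(** Gauss's lemma: the reduced denominator divides every denominator. *)
Lemma frac_common_factor (F : fieldType) (N D : {poly F}) (g : {fraction {poly F}}) :
  D != 0 -> g = N%:F / D%:F ->
  exists2 G, N = G * rat_num g & D = G * rat_den g.
Proof.
move=> D0 hg; have e0 := rat_den_neq0 g; have cop := rat_coprime g.
have E : rat_num g * D = N * rat_den g.
  have := rat_numden g; rewrite {1}hg => /eqP.
  by rewrite eqr_div ?tofrac_eq0 // -!tofracM tofrac_eq => /eqP ->.
have /dvdpP[G DE] : rat_den g %| D.
  rewrite -(@Gauss_dvdpr _ D (rat_num g)) 1?coprimep_sym //.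
  by rewrite E dvdp_mull.
exists G => //; apply: (mulIf e0); rewrite -E {1}DE; ring.
Qed.

(** On a finite set stable under the map, injectivity gives surjectivity, and
    the point at infinity never appears. *)
Lemma permutes_injective (F : finFieldType) (g : {fraction {poly F}})
    (S : {set F}) (f : F -> F) :
    {in S, forall t, rat_map g (Some t) = Some (f t)} ->
    {in S, forall t, f t \in S} ->
  permutes g S <-> {in S &, injective f}.
Proof.
move=> gf fS; split=> [[inj _] t u tS uS E|inj].
  have := inj (Some t) (Some u) (imset_f _ tS) (imset_f _ uS).
  by rewrite !gf // E => /(_ erefl)[].
have injg : {in [set Some x | x in S] &, injective (rat_map g)}.
  move=> _ _ /imsetP[t tS ->] /imsetP[u uS ->].
  by rewrite !gf // => -[/inj->].
split=> //; apply/eqP; rewrite eqEcard (card_in_imset injg) leqnn andbT.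
apply/subsetP => _ /imsetP[_ /imsetP[t tS ->] ->].
by rewrite gf //; apply: imset_f; apply: fS.
Qed.

(** * Conjugation over the subfield of order q *)

Section Conjugation.

Variables (m q : nat) (F : finFieldType).
Hypotheses (hm : (0 < m)%N) (hq : q = (2 ^ m)%N) (hF : #|F| = (q ^ 2)%N).

Let q_gt1 : (1 < q)%N.
Proof. by rewrite hq -{1}(expn0 2) ltn_exp2l. Qed.

Let q_gt0 : (0 < q)%N := ltnW q_gt1.

Lemma pchar2 : 2%N \in [pchar F].
Proof. by apply: (@card_finPcharP _ 2 (m * 2)) => //; rewrite hF hq expnM. Qed.

Lemma conjD (x y : F) : (x + y) ^+ q = x ^+ q + y ^+ q.
Proof.
by apply: exprDn_pchar; rewrite (eq_pnat _ (pcharf_eq pchar2)) hq pnatX pnat_id.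
Qed.

Lemma conjN (x : F) : (- x) ^+ q = - x ^+ q.
Proof. by rewrite !oppr_pchar2 ?pchar2. Qed.

Lemma conjK (x : F) : (x ^+ q) ^+ q = x.
Proof. by rewrite -exprM mulnn -hF expf_card. Qed.

Definition conjE := (conjD, conjN, exprMn, conjK).

Lemma muE (x : F) : (x \in mu F q.+1) = (x * x ^+ q == 1).
Proof. by rewrite inE -exprS; apply/unity_rootP/eqP. Qed.

Lemma muM (x y : F) : x \in mu F q.+1 -> y \in mu F q.+1 -> x * y \in mu F q.+1.
Proof.
by rewrite !muE exprMn mulrACA => /eqP-> /eqP->; rewrite mulr1.
Qed.

Lemma muV (x : F) : x \in mu F q.+1 -> x^-1 \in mu F q.+1.
Proof. by rewrite !muE exprVn -invfM => /eqP->; rewrite invr1. Qed.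

Lemma mu_neq0 (x : F) : x \in mu F q.+1 -> x != 0.
Proof.
by rewrite muE; apply: contraTneq => ->; rewrite mul0r eq_sym oner_eq0.
Qed.

Lemma mu_conj (x : F) : x \in mu F q.+1 -> x ^+ q = x^-1.
Proof.
move=> xmu; have x0 := mu_neq0 xmu.
by apply: (mulfI x0); rewrite divff //; apply/eqP; rewrite -muE.
Qed.

(** The easy half of Hilbert 90 for the extension of degree 2. *)
Lemma mu_divconj (x : F) : x != 0 -> x ^+ q / x \in mu F q.+1.
Proof.
move=> x0; rewrite muE exprMn conjK exprVn; apply/eqP.
have xq0 := expf_neq0 q x0; move: (x ^+ q) xq0 => y y0.
by field; rewrite x0 y0.
Qed.

Lemma mu_nontrivial : exists2 t : F, t \in mu F q.+1 & t != 1.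
Proof.
have sX : size ('X^q - 'X : {poly F}) = q.+1.
  by rewrite size_polyDl ?size_polyXn // size_polyN size_polyX.
(* A subfield of order q does not exhaust F. *)
have [x xq] : exists x : F, x ^+ q != x.
  apply/existsP; apply: contraTT isT => /existsPn allq.
  have X0 : 'X^q - 'X != 0 :> {poly F} by rewrite -size_poly_eq0 sX.
  have := max_poly_roots (rs := enum F) X0 _ (enum_uniq F).
  have qq : (q < q ^ 2)%N by rewrite -mulnn ltn_Pmulr.
  rewrite -cardE hF sX ltnS leqNgt qq => -> //.
  by apply/allP => x _; rewrite /root !hornerE subr_eq0; apply/negPn.
have x0 : x != 0 by apply: contraNneq xq => ->; rewrite expr0n gtn_eqF.
exists (x ^+ q / x); first exact: mu_divconj.
by apply: contraNneq xq => /divr1_eq/eqP.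
Qed.

(** * Self-reciprocal fractions of degree 2 on mu *)

(** Self-reciprocity: the numerator is, up to a power of the variable, the
    denominator evaluated at the conjugate inverse.  Applied a second time with
    the roles exchanged, it shows that the common roots of the two cubics are
    stable under s |-> s^(-q). *)
Lemma conj_horner_cubic (a b c d s : F) : s != 0 ->
  (cubic a b c d).[(s^-1) ^+ q] ^+ q
    = (cubic (d ^+ q) (c ^+ q) (b ^+ q) (a ^+ q)).[s] / s ^+ 3.
Proof.
move=> s0; rewrite !cubicE !conjD !exprMn -!(exprAC _ q) !conjK; field.
exact: s0.
Qed.

(** On mu the map s |-> s^(-q) is the identity, so numerator and denominator
    differ by a conjugation and a power of t; their quotient thus stays in mu. *)
Lemma conj_horner_quadratic (a b c t : F) : t \in mu F q.+1 ->
  (quadratic (c ^+ q) (b ^+ q) (a ^+ q)).[t] = t ^+ 2 * (quadratic a b c).[t] ^+ q.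
Proof.
move=> tmu; have t0 := mu_neq0 tmu.
rewrite !quadraticE !conjD !exprMn (mu_conj tmu); field.
exact: t0.
Qed.

Lemma quadratic_neq0_mu (a b c t : F) :
  coprimep (quadratic (c ^+ q) (b ^+ q) (a ^+ q)) (quadratic a b c) ->
  t \in mu F q.+1 -> (quadratic a b c).[t] != 0.
Proof.
move=> cop tmu; apply/eqP => Dt; apply: (no_common_root cop _ Dt).
by rewrite (conj_horner_quadratic _ _ _ tmu) Dt expr0n gtn_eqF ?mulr0.
Qed.

Lemma quadratic_div_mu (a b c t : F) :
  coprimep (quadratic (c ^+ q) (b ^+ q) (a ^+ q)) (quadratic a b c) ->
  t \in mu F q.+1 ->
  (quadratic (c ^+ q) (b ^+ q) (a ^+ q)).[t] / (quadratic a b c).[t]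
    \in mu F q.+1.
Proof.
move=> cop tmu; rewrite (conj_horner_quadratic _ _ _ tmu) -mulrA.
apply: muM; first by rewrite expr2 muM.
exact/mu_divconj/(quadratic_neq0_mu cop).
Qed.

Lemma two_eq0 : 2%:R = 0 :> F.
Proof. exact: pcharf0 pchar2. Qed.

Lemma sqr_inj (x y : F) : x ^+ 2 = y ^+ 2 -> x = y.
Proof.
move=> E; apply/eqP; rewrite -subr_eq0 -sqrf_eq0 sqrrB E -mulr_natr two_eq0.
by rewrite mulr0 subr0 -mulr2n -mulr_natr two_eq0 mulr0.
Qed.

(** A map of degree 2 comes with the involution exchanging the two points of
    each fibre.  Dividing N(t) D(u) - N(u) D(t) by t - u leaves
    P t u + Q (t + u) + P^q, with P the expression assumed nonzero and
    Q = c^(q+1) - a^(q+1), so the involution is t |-> - (Q t + P^q) / (P t + Q).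
    Since Q is fixed by conjugation it preserves mu.  In characteristic 2 it has
    a single fixed point, hence it moves some point of mu. *)
Lemma quadratic_collision (a b c : F) :
  let N := quadratic (c ^+ q) (b ^+ q) (a ^+ q) in
  let D := quadratic a b c in
  c ^+ q * b - a * b ^+ q != 0 ->
  exists t u, [/\ t \in mu F q.+1, u \in mu F q.+1, u != t
                & N.[t] * D.[u] = N.[u] * D.[t]].
Proof.
move=> N D; set P := _ - _ => P0.
set Q := c ^+ q * c - a ^+ q * a.
have Qq : Q ^+ q = Q by rewrite /Q !conjE; ring.
(* The involution fixes exactly the t with P t^2 = P^q; squaring being
   injective, at most one of two distinct points is fixed. *)
have [t tmu Pt] : exists2 t, t \in mu F q.+1 & P * t ^+ 2 != P ^+ q.
  have [s smu s1] := mu_nontrivial.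
  case: (eqVneq (P * 1 ^+ 2) (P ^+ q)) => [E|]; last first.
    by exists 1; rewrite // muE expr1n mulr1.
  by exists s => //; rewrite -E; apply: contraNneq s1 => /(mulfI P0)/sqr_inj->.
have t0 := mu_neq0 tmu.
have conjPQ : (P * t + Q) ^+ q = (Q * t + P ^+ q) / t.
  by rewrite conjD exprMn Qq (mu_conj tmu); field.
have PQ0 : P * t + Q != 0.
  apply: contraNneq Pt => E; move: conjPQ.
  rewrite E expr0n gtn_eqF //= ?mulr0n => /esym/eqP.
  rewrite mulf_eq0 invr_eq0 (negPf t0) orbF addr_eq0 => /eqP Qt.
  have -> : P * t ^+ 2 = - (Q * t).
    by apply/eqP; rewrite -addr_eq0 expr2 mulrA -mulrDl E mul0r.
  by rewrite Qt opprK.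
pose u := - (Q * t + P ^+ q) / (P * t + Q).
have QP0 : Q * t + P ^+ q != 0.
  apply: contraTneq PQ0 => E; move: conjPQ; rewrite E mul0r => /eqP.
  by rewrite expf_eq0 => /andP[_ ->].
have umu : u \in mu F q.+1.
  have conjQP : (Q * t + P ^+ q) ^+ q = (P * t + Q) / t.
    by rewrite conjD exprMn Qq conjK (mu_conj tmu); field.
  rewrite muE /u !(exprMn, conjN, exprVn) conjPQ conjQP; apply/eqP; field.
  by rewrite PQ0 QP0 t0.
exists t, u; split=> //.
  apply: contraNneq Pt => /(canRL (mulfVK PQ0)) E; apply/eqP.
  have -> : P ^+ q = - (Q * t + P ^+ q) + 2%:R * P ^+ q + Q * t by ring.
  rewrite E; transitivity (P * t ^+ 2 + 2%:R * (Q * t + P ^+ q)).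
    by rewrite two_eq0 mul0r addr0.
  by ring.
have uE : u * (P * t + Q) = - (Q * t + P ^+ q) by rewrite mulfVK.
apply/eqP; rewrite -subr_eq0; apply/eqP.
transitivity ((t - u) * (u * (P * t + Q) + (Q * t + P ^+ q))); last first.
  by rewrite uE addNr mulr0.
(* The cross difference factors as t - u times a symmetric bilinear form. *)
move: u {umu uE} => u.
rewrite /N /D !quadraticE /P conjD conjN !exprMn !conjK /Q; ring.
Qed.

(** Equality of the norms would make N = c^q X^2 + a^q and D = a X^2 + c
    proportional. *)
Lemma coprime_norm_neq (a b c : F) :
  let N := quadratic (c ^+ q) (b ^+ q) (a ^+ q) in
  let D := quadratic a b c in
  coprimep N D -> (1 < maxn (size N) (size D))%N ->
  b = 0 -> a * a ^+ q != c * c ^+ q.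
Proof.
move=> N D cop sz b0; apply/eqP => ac.
have [a0 cq0] : a = 0 /\ c ^+ q = 0.
  apply: (coprimep_scale_eq0 cop sz); apply/polyP => k.
  rewrite !coefZ !coef_quadratic b0 expr0n gtn_eqF //.
  by case: k => [|[|[|k]]] /=; rewrite ?nth_nil ?mulr0 // mulrC // mulrC ac mulrC.
have c0 : c = 0 by apply/eqP; move/eqP: cq0; rewrite expf_eq0 => /andP[].
by move: sz; rewrite /N /D a0 b0 c0 expr0n gtn_eqF // /quadratic !scale0r
  !addr0 size_poly0.
Qed.

(** In characteristic 2 a map of degree 2 is either separable, and then not
    injective on mu by the collision above, or a function of t^2, and then
    a Moebius map in t^2, whose determinant is nonzero by the previous lemma. *)
Lemma quadratic_injective_mu (a b c : F) :
  let N := quadratic (c ^+ q) (b ^+ q) (a ^+ q) in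
  let D := quadratic a b c in
  coprimep N D -> (1 < maxn (size N) (size D))%N ->
  {in mu F q.+1 &, injective (fun t => N.[t] / D.[t])} <-> b = 0.
Proof.
move=> N D cop sz; have indep := coprimep_scale_eq0 cop sz.
have D0 t : t \in mu F q.+1 -> D.[t] != 0 by exact: quadratic_neq0_mu.
split=> [inj|b0 t u tmu umu /eqP].
  have [P0|P0] := eqVneq (c ^+ q * b - a * b ^+ q) 0.
    (* Here N and D would be proportional: b^q D = b N. *)
    have Pq : b ^+ q * c - b * a ^+ q = 0.
      have := congr1 (fun x => x ^+ q) P0.
      rewrite conjD conjN !exprMn !conjK expr0n gtn_eqF //= ?mulr0n => Pq.
      by rewrite -Pq; ring.
    have [] // := indep b (b ^+ q) _.
    apply/polyP => k; rewrite !coefZ !coef_quadratic; case: k => [|[|[|k]]] /=.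
    - by apply/eqP; rewrite eq_sym -subr_eq0 Pq.
    - exact: mulrC.
    - by apply/eqP; rewrite mulrC [b ^+ q * a]mulrC -subr_eq0 P0.
    - by rewrite nth_nil !mulr0.
  have [t [u [tmu umu ut E]]] := quadratic_collision P0.
  case/eqP: ut; apply: inj => //; apply/eqP.
  by rewrite eqr_div ?D0 // -E.
rewrite eqr_div ?D0 // /N /D !quadraticE b0 expr0n gtn_eqF //= ?mulr0n => /eqP E.
apply: sqr_inj; apply/eqP; rewrite -subr_eq0.
have /eqP : (c ^+ q * c - a ^+ q * a) * (t ^+ 2 - u ^+ 2) = 0.
  by move/eqP: E; rewrite -subr_eq0 => /eqP E; rewrite -E; ring.
rewrite mulf_eq0 => /orP[/eqP/subr0_eq Q0|//].
by have /eqP[] := coprime_norm_neq cop sz b0; rewrite mulrC -Q0 mulrC.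
Qed.

(** * Cancelling the common factor *)

(** Passing from degree 3 to degree 2 can only be due to a common factor of
    degree 1; self-reciprocity confines its root to mu. *)
Lemma common_factor_linear (a b c d : F) (G n e : {poly F}) :
  coprimep n e -> maxn (size n) (size e) = 3%N -> cubic a b c d != 0 ->
  cubic (d ^+ q) (c ^+ q) (b ^+ q) (a ^+ q) = G * n -> cubic a b c d = G * e ->
  exists r k, [/\ r \in mu F q.+1, k != 0 & G = k *: ('X + r%:P)].
Proof.
pose N := cubic (d ^+ q) (c ^+ q) (b ^+ q) (a ^+ q).
rewrite -/N => cop sz D0 NE DE.
have G0 : G != 0 by apply: contraNneq D0 => G0; rewrite DE G0 mul0r.
(* Whichever of n and e has degree 2 bounds the degree of G. *)
have bound j : (size N <= j)%N -> (size (cubic a b c d) <= j)%N ->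
    (size G <= j - 2)%N.
  have half (p : {poly F}) :
      size p = 3%N -> (size (G * p)%R <= j)%N -> (size G <= j - 2)%N.
    move=> p3; rewrite size_mul // -?size_poly_eq0 ?p3 // addnS /= addn2 => sj.
    by rewrite -(addnK 2 (size G)) leq_sub2r // addn2.
  rewrite NE DE => sN sD; have [en|ne] := leqP (size e) (size n).
    by apply: (half n) => //; rewrite -sz (maxn_idPl en).
  by apply: (half e) => //; rewrite -sz (maxn_idPr (ltnW ne)).
have sG : (size G <= 2)%N by apply: (bound 4%N); rewrite size_cubic.
have common t : (cubic a b c d).[t] = 0 -> N.[t] = 0 -> G.[t] = 0.
  rewrite NE DE !hornerM => /eqP; rewrite mulf_eq0 => /orP[/eqP//|/eqP et] /eqP.
  rewrite mulf_eq0 => /orP[/eqP//|/eqP nt].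
  by case: (no_common_root cop nt et).
(* If a = d = 0, both cubics are divisible by 'X, hence so is G; but then their
   degrees are at most 2 and G is a nonzero constant. *)
have ad0 : (a == 0) && (d == 0) = false.
  apply/negP => /andP[/eqP a0 /eqP d0].
  have zq : 0 ^+ q = 0 :> F by rewrite expr0n gtn_eqF.
  have sG1 : (size G <= 1)%N.
    by apply: (bound 3%N); apply/leq_sizeP => -[|[|[|[|i]]]] // _;
      rewrite coef_cubic /= ?a0 ?d0 ?nth_nil.
  have := common 0; rewrite !cubicE a0 d0 zq !(mul0r, mulr0, expr0n, addr0) /=.
  move=> /(_ erefl erefl); rewrite (size1_polyC sG1) hornerC => G00.
  by move: G0; rewrite (size1_polyC sG1) G00 eqxx.
have G1 : G`_1 != 0.
  apply: contraFneq ad0 => G1.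
  have GC : G = (G`_0)%:P.
    apply: size1_polyC; apply/leq_sizeP => -[|[|i]] // _.
    by rewrite nth_default // (leq_trans sG).
  have n3 : n`_3 = 0 by rewrite nth_default // -sz leq_maxl.
  have e3 : e`_3 = 0 by rewrite nth_default // -sz leq_maxr.
  have /(congr1 (coefp 3)) := DE; have /(congr1 (coefp 3)) := NE.
  rewrite /= GC !coefCM !coef_cubic /= n3 e3 mulr0.
  by move=> /eqP; rewrite expf_eq0 => /andP[_ ->] ->; rewrite eqxx.
pose k := G`_1; pose r := G`_0 / k.
have GE : G = k *: ('X + r%:P).
  apply/polyP => i; rewrite coefZ coefD coefX coefC.
  case: i => [|[|i]] /=; rewrite ?addr0 ?add0r ?mulr1 //; first by rewrite mulrC divfK.
  by rewrite mulr0 nth_default // (leq_trans sG).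
have rootG t : G.[t] = 0 -> t = - r.
  rewrite GE !hornerE => /eqP; rewrite mulf_eq0 (negPf G1) /= addr_eq0.
  by move/eqP.
exists r, k; split=> //.
have Gs : G.[- r] = 0 by rewrite GE !hornerE addNr mulr0.
have Ds : (cubic a b c d).[- r] = 0 by rewrite DE hornerM Gs mul0r.
have Ns : N.[- r] = 0 by rewrite NE hornerM Gs mul0r.
have s0 : - r != 0.
  apply: contraFneq ad0 => s0; move: Ds Ns.
  rewrite !cubicE s0 !(mulr0, expr0n, add0r) /= ?mulr0 ?add0r => -> /eqP.
  by rewrite expf_eq0 => /andP[_ ->]; rewrite eqxx.
(* By self-reciprocity the conjugate inverse of the common root - r is again a
   common root, and G has only one root. *)
have sE : ((- r)^-1) ^+ q = - r.
  apply/rootG/common.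
    have /eqP := conj_horner_cubic a b c d s0.
    by rewrite -/N Ns mul0r expf_eq0 => /andP[_ /eqP].
  have /eqP := conj_horner_cubic (d ^+ q) (c ^+ q) (b ^+ q) (a ^+ q) s0.
  by rewrite !conjK Ds mul0r expf_eq0 => /andP[_ /eqP].
by rewrite muE -mulrNN -conjN -{1}sE exprVn mulVf ?expf_neq0.
Qed.

(** After division by X + r the fraction keeps the self-reciprocal shape, one
    degree lower, up to the factor r^-1 which is a unit of norm 1.  The scalar k
    accounts for the reduced form being defined only up to a constant. *)
Lemma reduced_form (a b c d : F) (g : {fraction {poly F}}) :
  g = (cubic (d ^+ q) (c ^+ q) (b ^+ q) (a ^+ q))%:F / (cubic a b c d)%:F ->
  rat_deg g = 2%N -> cubic a b c d != 0 ->
  exists r B C k, [/\ [/\ r \in mu F q.+1, b = B + r * a, c = C + r * B & d = r * C],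
    k != 0, k *: rat_den g = quadratic a B C
    & k *: rat_num g = r^-1 *: quadratic (C ^+ q) (B ^+ q) (a ^+ q)].
Proof.
move=> hg hdeg D0; have [G NE DE] := frac_common_factor D0 hg.
have cop := rat_coprime g.
have sz : maxn (size (rat_num g)) (size (rat_den g)) = 3%N.
  move: hdeg; rewrite /rat_deg.
  case: (size (rat_num g)) => [|x]; case: (size (rat_den g)) => [|y] //=.
  - by rewrite !max0n => ->.
  - by rewrite !maxn0 => ->.
  - by rewrite maxnSS => ->.
have [r [k [rmu k0 GE]]] := common_factor_linear cop sz D0 NE DE.
have r0 := mu_neq0 rmu.
pose A := (k *: rat_den g)`_2.
pose B := (k *: rat_den g)`_1; pose C := (k *: rat_den g)`_0.
have denE : k *: rat_den g = quadratic A B C.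
  by apply: poly_size3; rewrite size_scale // -sz leq_maxr.
have DE' : cubic a b c d = cubic A (B + r * A) (C + r * B) (r * C).
  by rewrite -mulXD_quadratic -denE DE GE -scalerAl scalerAr.
have [aE bE cE dE] : [/\ a = A, b = B + r * A, c = C + r * B & d = r * C].
  by split; [have := congr1 (coefp 3) DE' | have := congr1 (coefp 2) DE'
    | have := congr1 (coefp 1) DE' | have := congr1 (coefp 0) DE'];
    rewrite /= !coef_cubic.
exists r, B, C, k; rewrite -aE in bE denE *; split=> //.
have X0 : 'X + r%:P != 0 by rewrite -size_poly_eq0 size_XaddC.
apply: (mulfI X0); rewrite -!scalerAr scalerAl -GE -NE mulXD_quadratic.
apply/polyP => i; rewrite coefZ !coef_cubic bE cE dE !conjD !exprMn (mu_conj rmu).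
by case: i => [|[|[|[|i]]]] /=; rewrite ?nth_nil ?mulr0 //; field.
Qed.

(** When B = 0 the cubic is (X + r) (a X^2 + C), that is b = r a and d = r c; the
    three cases are C = 0, a = 0 and a C != 0, and all the quotients equal r. *)
Lemma middle_coef0_conditions (r a B C : F) :
  r \in mu F q.+1 -> (B = 0 -> a * a ^+ q != C * C ^+ q) ->
  let b := B + r * a in let c := C + r * B in let d := r * C in
  B = 0 <->
  [\/ [/\ c = 0, d = 0, a != 0, b != 0 & a / b \in mu F q.+1],
      [/\ c != 0, d != 0, a = 0, b = 0 & d / c \in mu F q.+1]
    | [/\ a != 0, b != 0, c != 0 & d != 0] /\
      d ^+ q * c - a * b ^+ q != 0 /\
      [/\ c ^+ q / d ^+ q = b / a,
          b / a = d / c,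
          d / c = a ^+ q / b ^+ q,
          a ^+ q / b ^+ q
            = (d ^+ q.+1 - a ^+ q.+1) / (d ^+ q * c - a * b ^+ q)
        & (d ^+ q.+1 - a ^+ q.+1) / (d ^+ q * c - a * b ^+ q)
            \in mu F q.+1]].
Proof.
move=> rmu aC b c d; have r0 := mu_neq0 rmu; have rq := mu_conj rmu.
have mulr_eq0r (x : F) : r * x = 0 -> x = 0.
  by move/eqP; rewrite mulf_eq0 (negPf r0) => /eqP.
split=> [B0|].
  have {}aC := aC B0; rewrite /b /c /d B0 add0r mulr0 addr0.
  have [a0|a0] := eqVneq a 0.
    have C0 : C != 0.
      by apply: contraNneq aC => C0; rewrite a0 C0 !mul0r.
    by apply: Or32; rewrite mulf_neq0 // a0 mulr0 mulfK.
  have [C0|C0] := eqVneq C 0.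
    apply: Or31; rewrite C0 mulr0 mulf_neq0 // invfM mulrCA mulfV // mulr1.
    by split=> //; apply: muV.
  have [aq0 Cq0] := (expf_neq0 q a0, expf_neq0 q C0).
  apply: Or33; rewrite !mulf_neq0 //; split=> //.
  rewrite !exprS !exprMn rq; move: (a ^+ q) (C ^+ q) aq0 Cq0 aC => a' C' a'0 C'0 aC.
  have den0 : r^-1 * C' * C - a * (r^-1 * a') != 0.
    have -> : r^-1 * C' * C - a * (r^-1 * a') = (C * C' - a * a') / r by field.
    by rewrite mulf_neq0 ?invr_eq0 // subr_eq0 eq_sym.
  have -> : (r * C * (r^-1 * C') - a * a') / (r^-1 * C' * C - a * (r^-1 * a')) = r.
    by apply: (canLR (mulfK den0)); field.
  split=> //; split=> //; try by field; rewrite ?a0 ?C0 ?a'0 ?C'0 ?r0.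
case=> [[c0 d0 _ _ _]|[_ _ a0 b0 _]|[[a0 b0 c0 d0] [den0 [_ ba dc fr rho_mu]]]].
- by apply: (mulr_eq0r B); rewrite -c0 /c (mulr_eq0r C d0) add0r.
- by rewrite -b0 /b a0 mulr0 addr0.
(* With rho the common value of the quotients, b = rho a and d = rho c, so that
   b c = a d. *)
move: rho_mu; rewrite -fr -dc -ba; set rho := b / a => rho_mu.
have bE : b = rho * a by rewrite /rho divfK.
have dE : d = rho * c by rewrite /rho ba divfK.
have : B * (c + r * (r * a)) = 0.
  have -> : B * (c + r * (r * a)) = b * c - a * d by rewrite /b /c /d; ring.
  by rewrite bE dE; ring.
move/eqP; rewrite mulf_eq0 => /orP[/eqP//|]; rewrite addr_eq0 => /eqP cE.
(* The other factor makes a and c of equal norm, which kills the denominator of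
   the last quotient. *)
case/eqP: den0.
have rhoq := mu_conj rho_mu; have rho0 := mu_neq0 rho_mu.
clearbody rho; rewrite dE cE bE !(exprMn, conjN) rhoq rq; field.
by rewrite rho0 r0.
Qed.

End Conjugation.

(** * Permutation criterion *)

Theorem theorem2 (m q : nat) (hm : (0 < m)%N) (hq : q = (2 ^ m)%N)
    (F : finFieldType) (hF : #|F| = (q ^ 2)%N) (a b c d : F)
    (habcd : ~ [/\ a = 0, b = 0, c = 0 & d = 0])
    (g : {fraction {poly F}})
    (hg : g = ((d ^+ q) *: 'X^3 + (c ^+ q) *: 'X^2 + (b ^+ q) *: 'X
                 + (a ^+ q)%:P)%:F
              / (a *: 'X^3 + b *: 'X^2 + c *: 'X + d%:P)%:F)
    (hdeg : rat_deg g = 2%N) :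
  permutes g (mu F q.+1) <->
  [\/ [/\ c = 0, d = 0, a != 0, b != 0 & a / b \in mu F q.+1],
      [/\ c != 0, d != 0, a = 0, b = 0 & d / c \in mu F q.+1]
    | [/\ a != 0, b != 0, c != 0 & d != 0] /\
      d ^+ q * c - a * b ^+ q != 0 /\
      [/\ c ^+ q / d ^+ q = b / a,
          b / a = d / c,
          d / c = a ^+ q / b ^+ q,
          a ^+ q / b ^+ q
            = (d ^+ q.+1 - a ^+ q.+1) / (d ^+ q * c - a * b ^+ q)
        & (d ^+ q.+1 - a ^+ q.+1) / (d ^+ q * c - a * b ^+ q)
            \in mu F q.+1]].
Proof.
have D0 : cubic a b c d != 0.
  apply/eqP => E; apply: habcd.
  by split; [have := congr1 (coefp 3) E | have := congr1 (coefp 2) E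
    | have := congr1 (coefp 1) E | have := congr1 (coefp 0) E];
    rewrite /= coef_cubic coef0.
have [r [B [C [k [[rmu bE cE dE] k0 denE numE]]]]] :=
  reduced_form hm hq hF hg hdeg D0.
pose n := quadratic (C ^+ q) (B ^+ q) (a ^+ q); pose e := quadratic a B C.
have r0 := mu_neq0 rmu.
have cop : coprimep n e.
  have := rat_coprime g.
  by rewrite -(coprimepZl _ _ k0) -(coprimepZr _ _ k0) numE denE coprimepZl ?invr_eq0.
have sz : (1 < maxn (size n) (size e))%N.
  move: hdeg; rewrite /rat_deg -(size_scale (rat_num g) k0) -(size_scale (rat_den g) k0).
  rewrite numE denE size_scale ?invr_eq0 // -/n -/e leq_max.
  by case: (size n) => [|[|x]]; case: (size e) => [|[|y]].
have e0 t : t \in mu F q.+1 -> e.[t] != 0 by exact: (quadratic_neq0_mu hm hq hF cop).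
have mapE t : t \in mu F q.+1 -> rat_map g (Some t) = Some (r^-1 * (n.[t] / e.[t])).
  move=> tmu; have et := e0 t tmu.
  have dt : k * (rat_den g).[t] = e.[t] by rewrite -hornerZ denE.
  have nt : k * (rat_num g).[t] = r^-1 * n.[t] by rewrite -hornerZ numE hornerZ.
  rewrite /rat_map ifN; last by apply: contraNneq et => dt0; rewrite -dt dt0 mulr0.
  by rewrite mulrA -dt -nt -mulf_div divff // mul1r.
have mapmu t : t \in mu F q.+1 -> r^-1 * (n.[t] / e.[t]) \in mu F q.+1.
  by move=> tmu; apply: muM; [exact: muV | exact: (quadratic_div_mu hm hq hF cop)].
have permE := permutes_injective mapE mapmu.
have injE := quadratic_injective_mu hm hq hF cop sz.
have condE := middle_coef0_conditions hq hF rmu (a := a) (B := B) (C := C) _.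
rewrite -bE -cE -dE in condE.
apply: iff_trans permE (iff_trans _ (condE _)); last first.
  exact: (coprime_norm_neq hm hq cop sz).
apply: iff_trans injE; split=> inj t u tmu umu /= E; apply: inj => //=.
  by rewrite E.
by apply: (mulfI _ E); rewrite invr_eq0.
Qed.
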